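(* Let $n\ge2$, let $\mathcal H$ be a real Hilbert space, let $A_1,\dots,A_n:\mathcal H\rightrightarrows\mathcal H$ be maximal monotone operators such that there exists $x\in\mathcal H$ with $0\in\sum_{i=1}^nA_i(x)$, and let $\gamma\in\mathbb R$ be a step size. Let $M\in\mathbb R^{d\times n}$ and let $L\in\mathbb R^{n\times n}$ be lower triangular, such that $W=M^TM$ and $Z=2\,\mathrm{Id}-L-L^T$ satisfy, for some constants $c>0$, $\varepsilon\in[0,2)$ and some set $\mathcal C\subseteq\mathbb S^n_+\times\mathbb S^n$, the constraints $$W\in\mathbb S^n_+,\ Z\in\mathbb S^n,\ W\mathbb 1=0,\ \lambda_1(W)+\lambda_2(W)\ge c,\ Z-W\succeq0,\ \mathbb 1^TZ\mathbb 1=0,\ \mathrm{diag}(Z)=Z_{11}\mathbb 1,\ 2-\varepsilon\le Z_{11}\le2+\varepsilon,\ (W,Z)\in\mathcal C.$$ Then there exists $\tilde M\in\mathbb R^{(n-1)\times n}$ such that for any initial point $\mathbf z^0\in\mathcal H^d$ there is an initial point $\tilde{\mathbf z}^0\in\mathcal H^{n-1}$ for which the iterations $$\mathbf x^k=J_{\mathbf A}(-\mathbf M^T\mathbf z^k+\mathbf L\mathbf x^k),\qquad\mathbf z^{k+1}=\mathbf z^k+\gamma\mathbf M\mathbf x^k$$ and $$\mathbf x^k=J_{\mathbf A}(-\tilde{\mathbf M}^T\tilde{\mathbf z}^k+\mathbf L\mathbf x^k),\qquad\tilde{\mathbf z}^{k+1}=\tilde{\mathbf z}^k+\gamma\tilde{\mathbf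 M}\mathbf x^k$$ produce the same sequence of $\mathbf x$ values. That is, every frugal resolvent splitting given by the first iteration has an equivalent frugal resolvent splitting with minimal lifting (i.e. lifted dimension $n-1$).
   Context: $\mathbb S^n$ is the set of real symmetric $n\times n$ matrices, $\mathbb S^n_+$ the positive semidefinite ones, $\succeq$ the Loewner order, $\lambda_1(K)\le\dots\le\lambda_n(K)$ the eigenvalues in increasing order, $\mathbb 1$ the all-ones vector. Bold matrices denote Kronecker lifts: for a real matrix $K$, $\mathbf K=K\otimes\mathrm{Id}$ acts on tuples of elements of $\mathcal H$, and $\mathbf K^T=K^T\otimes\mathrm{Id}$. $\mathbf A(x_1,\dots,x_n)=A_1(x_1)\times\dots\times A_n(x_n)$ and $J_{\mathbf A}=(\mathrm{Id}+\mathbf A)^{-1}$ is its resolvent. In each iteration $\mathbf x^k\in\mathcal H^n$ is the solution of the displayed fixed-point equation, computable component by component since $L$ is lower triangular with diagonal entries less than $1$. The dimension of the lifting is the number of copies of $\mathcal H$ in which the iterate $\mathbf z$ lives. *)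

(* Defs.v *)
From HB Require Import structures.
From mathcomp Require Import all_boot all_order all_algebra.
From mathcomp Require Import polyrcf.
From mathcomp Require Import all_classical all_reals all_analysis.

Set Implicit Arguments.
Unset Strict Implicit.
Unset Printing Implicit Defensive.

Import Order.TTheory GRing.Theory Num.Theory.
Import numFieldNormedType.Exports.

Local Open Scope classical_set_scope.
Local Open Scope ring_scope.

Definition psdmx (R : realType) (n : nat) (K : 'M[R]_n) : Prop :=
  K \is symmetricmx /\ forall v : 'cV[R]_n, 0 <= (v^T *m K *m v) 0 0.

Definition loewner_ge (R : realType) (n : nat) (K K' : 'M[R]_n) : Prop :=
  psdmx (K - K').

(* [rootsR] lists the distinct real roots in increasing order.  A symmetric K
   has only real eigenvalues, so its spectrum has length n. *)
Definition spectrum (R : realType) (n : nat) (K : 'M[R]_n) : seq R :=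
  flatten [seq nseq (mup a (char_poly K)) a | a <- rootsR (char_poly K)].

(* Eigenvalues are numbered from 1. *)
Definition lambda (R : realType) (n : nat) (i : nat) (K : 'M[R]_n) : R :=
  (spectrum K)`_i.-1.

Definition first_index (n : nat) (hn : (2 <= n)%N) : 'I_n := Ordinal (ltnW hn).

(* A set-valued operator V => V is a map V -> set V. *)
Definition resolvent (V : zmodType) (T : V -> set V) (w : V) : set V :=
  [set x | exists2 u, T x u & x + u = w].

Definition sum_op (V : zmodType) (n : nat) (A : 'I_n -> V -> set V)
    (x : V) : set V :=
  [set \sum_i u i | u in [set u : 'I_n -> V | forall i, A i x (u i)]].

Definition prod_op (V : Type) (n : nat) (A : 'I_n -> V -> set V)
    (x : {ffun 'I_n -> V}) : set {ffun 'I_n -> V} :=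
  [set u | forall i, A i (x i) (u i)].

Definition monotone_op (R : realType) (H : lmodType R) (ip : H -> H -> R)
    (T : H -> set H) : Prop :=
  forall x y u v, T x u -> T y v -> 0 <= ip (x - y) (u - v).

Definition maximal_monotone (R : realType) (H : lmodType R)
    (ip : H -> H -> R) (T : H -> set H) : Prop :=
  monotone_op ip T /\
  forall S : H -> set H, monotone_op ip S ->
    (forall x, T x `<=` S x) -> S = T.

(* The action of the Kronecker product K (x) Id. *)
Definition lift_mx (R : realType) (H : lmodType R) (m n : nat)
    (K : 'M[R]_(m, n)) (x : {ffun 'I_n -> H}) : {ffun 'I_m -> H} :=
  [ffun i => \sum_j K i j *: x j].

(* The x-sequences produced from the initial point z0.  The resolvent is
   set-valued a priori; "= [set x k]" says that it is single-valued at the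
   given argument, with value x k. *)
Definition x_sequences (R : realType) (H : lmodType R) (n d : nat)
    (A : 'I_n -> H -> set H) (gamma : R) (L : 'M[R]_n) (M : 'M[R]_(d, n))
    (z0 : {ffun 'I_d -> H}) : set (nat -> {ffun 'I_n -> H}) :=
  [set x | exists z : nat -> {ffun 'I_d -> H},
     z 0%N = z0 /\
     forall k,
       resolvent (prod_op A) (- lift_mx M^T (z k) + lift_mx L (x k))
         = [set x k] /\
       z k.+1 = z k + gamma *: lift_mx M (x k)].

(* Main.v *)
Require Import Defs.
From HB Require Import structures.
From mathcomp Require Import all_boot all_order all_algebra.
From mathcomp Require Import all_classical all_reals all_analysis.
From mathcomp Require Import ring lra.

Set Implicit Arguments.
Unset Strict Implicit.
Unset Printing Implicit Defensive.

Import Order.TTheory GRing.Theory Num.Theory.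
Import numFieldNormedType.Exports.

Local Open Scope classical_set_scope.
Local Open Scope ring_scope.

(** Write [v k = M^T z k].  The iteration for [M] reads
    [x k = J_A (- v k + L (x k))] and [v k.+1 = v k + gamma W (x k)] with
    [W = M^T M], so the sequence [x] depends on [M] and [z 0] only through [W]
    and [M^T z 0] ([x_sequences_gram]).  It therefore suffices to find [T] with
    [n - 1] rows such that [T^T T = W] and every vector [M^T z] is of the form
    [T^T (P z)]; then [T] and the initial point [P (z 0)] produce the same [x].

    Such a factor exists because [W 1 = 0] forces [M 1 = 0]: the first column
    of [M] is minus the sum of the other ones, so [M = N B] where [N] consists
    of the last [n - 1] columns.  A QR decomposition of [N], obtained by
    Gram-Schmidt orthogonalization and made square so that it covers any number
    of rows of [M] and any rank, replaces [N] by an [n - 1] by [n - 1] matrix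
    with the same Gram matrix ([square_gram_factor], [short_gram_factor]).

    The theorem also claims that the iteration is well defined.  The constraints
    on the diagonal of [Z] give [L i i < 1], and [L] is lower triangular, so the
    fixed-point equation is solved one component at a time: component [i] asks
    for [x] with [w - (1 - L i i) x] in [A i x]
    ([lower_triangular_solve], [lower_triangular_uniq]).  Uniqueness is
    monotonicity; existence is Minty's theorem ([minty]).

    Minty's theorem is proved with the Fitzpatrick function
    [F (x, u) = sup (<x, v> + <y, u> - <y, v>)], the supremum being over the
    points [(y, v)] of the graph.  Maximality gives [F (x, u) >= <x, u>].  The
    function [F + (|x|^2 + |u|^2) / 2] is strongly convex, closed and
    nonnegative, so completeness alone yields a minimizer [(x0, u0)], and the
    first-order condition there shows that [(- u0, - x0)] is in the graph and
    that [u0 = - x0]. *)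

(** * Inner products and limits *)

Lemma ip_sym (R : realType) (H : lmodType R) (ip : {dot H for idfun})
    (x y : H) : ip x y = ip y x.
Proof. by rewrite hermC expr0 mul1r. Qed.

Lemma ip_addl (R : realType) (H : lmodType R) (ip : {dot H for idfun})
    (x y z : H) : ip (x + y) z = ip x z + ip y z.
Proof. exact: linearDl. Qed.

Lemma ip_addr (R : realType) (H : lmodType R) (ip : {dot H for idfun})
    (x y z : H) : ip z (x + y) = ip z x + ip z y.
Proof. exact: linearDr. Qed.

Lemma ip_oppl (R : realType) (H : lmodType R) (ip : {dot H for idfun})
    (x z : H) : ip (- x) z = - ip x z.
Proof. exact: linearNl. Qed.

Lemma ip_oppr (R : realType) (H : lmodType R) (ip : {dot H for idfun})
    (x z : H) : ip z (- x) = - ip z x.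
Proof. exact: linearNr. Qed.

Lemma ip_scalel (R : realType) (H : lmodType R) (ip : {dot H for idfun})
    (a : R) (x z : H) : ip (a *: x) z = a * ip x z.
Proof. exact: linearZl_LR. Qed.

Lemma ip_scaler (R : realType) (H : lmodType R) (ip : {dot H for idfun})
    (a : R) (x z : H) : ip z (a *: x) = a * ip z x.
Proof. exact: linearZr_LR. Qed.

Definition ipE := (ip_addl, ip_addr, ip_oppl, ip_oppr, ip_scalel, ip_scaler).

(** Polarization; it transfers continuity from the norm to the inner product. *)
Lemma ip_polar (R : realType) (H : completeNormedModType R)
    (ip : {dot H for idfun}) (hip : forall x : H, ip x x = `|x| ^+ 2)
    (x y : H) : ip x y = (`|x + y| ^+ 2 - `|x - y| ^+ 2) / 4.
Proof.
rewrite -!hip !ipE (ip_sym ip y x) /=.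
lra.
Qed.

Lemma cvg_ip (R : realType) (H : completeNormedModType R)
    (ip : {dot H for idfun}) (hip : forall x : H, ip x x = `|x| ^+ 2)
    (x y : nat -> H) (a b : H) :
  x @ \oo --> a -> y @ \oo --> b -> ip (x k) (y k) @[k --> \oo] --> ip a b.
Proof.
move=> xa yb; rewrite (ip_polar hip).
have -> : (fun k => ip (x k) (y k)) =
    (fun k => (`|x k + y k| ^+ 2 - `|x k - y k| ^+ 2) / 4).
  by apply: funext => k; exact: ip_polar.
apply: cvgMl; apply: cvgB; rewrite expr2; under eq_fun do rewrite expr2.
- by apply: cvgM; apply: cvg_norm; apply: cvgD.
- by apply: cvgM; apply: cvg_norm; apply: cvgB.
Qed.

Lemma cvg_of_sqr_dist (R : realType) (H : completeNormedModType R)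
    (u : nat -> H) (delta : nat -> R) :
  delta @ \oo --> (0 : R) ->
  (forall p q, `|u p - u q| ^+ 2 <= delta p + delta q) ->
  exists l : H, u @ \oo --> l.
Proof.
move=> d0 hu; suff /cvg_ex : cvg (u @ \oo) by [].
apply: cauchy_cvg; apply: cauchy_exP => e e0.
have e2 : 0 < e ^+ 2 / 2 by rewrite divr_gt0 ?exprn_gt0.
have /cvgrPdist_lt /(_ _ e2) [N _ hN] := d0.
have hd k : (N <= k)%N -> delta k < e ^+ 2 / 2.
  move=> Nk; have := hN k Nk; rewrite /= sub0r normrN.
  by apply: le_lt_trans; exact: ler_norm.
exists (u N); exists N => // k /= Nk; rewrite -ball_normE /=.
rewrite -(@ltr_pXn2r _ 2) ?nnegrE ?normr_ge0 ?(ltW e0) //.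
apply: le_lt_trans (hu N k) _.
have := hd N (leqnn N); have := hd k Nk; lra.
Qed.

(** * Minty's theorem *)

(** [E x u t] stands for membership of [((x, u), t)] in the epigraph of a convex
    closed function [f] on pairs.  If [f] plus half the squared norm is bounded
    below, it attains its infimum.  By the parallelogram identity every
    minimizing sequence is Cauchy, so no weak compactness is needed. *)
Lemma epigraph_minimizer (R : realType) (H : completeNormedModType R)
    (ip : {dot H for idfun}) (hip : forall x : H, ip x x = `|x| ^+ 2)
    (E : H -> H -> R -> Prop) (b : R) :
  (exists x u t, E x u t) ->
  (forall x u t x' u' t' s, E x u t -> E x' u' t' -> 0 <= s <= 1 ->
     E (x + s *: (x' - x)) (u + s *: (u' - u)) (t + s * (t' - t))) ->
  (forall (x u : nat -> H) (t : nat -> R) x0 u0 t0,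
     (forall k, E (x k) (u k) (t k)) ->
     x @ \oo --> x0 -> u @ \oo --> u0 -> t @ \oo --> t0 -> E x0 u0 t0) ->
  (forall x u t, E x u t -> b <= t + (ip x x + ip u u) / 2) ->
  exists x0 u0 t0, E x0 u0 t0 /\ forall x u t, E x u t ->
    t0 + (ip x0 x0 + ip u0 u0) / 2 <= t + (ip x x + ip u u) / 2.
Proof.
move=> [x1 [u1 [t1 E1]]] Econv Eclos Elb.
pose F := [set f | exists x u t, E x u t /\ f = t + (ip x x + ip u u) / 2].
have Flb : has_lbound F by exists b => f [x [u [t [Et ->]]]]; exact: Elb.
have Finf : has_inf F.
  by split=> //; exists (t1 + (ip x1 x1 + ip u1 u1) / 2), x1, u1, t1.
set m := inf F.
have Em x u t : E x u t -> m <= t + (ip x x + ip u u) / 2.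
  by move=> Et; apply: ge_inf => //; exists x, u, t.
have /choice [w hw] k : exists w : H * H * R, E w.1.1 w.1.2 w.2 /\
    w.2 + (ip w.1.1 w.1.1 + ip w.1.2 w.1.2) / 2 < m + k.+1%:R^-1.
  have k0 : 0 < k.+1%:R^-1 :> R by rewrite invr_gt0.
  have [f [x [u [t [Et ->]]]] lef] := inf_adherent k0 Finf.
  by exists (x, u, t).
pose x k := (w k).1.1; pose u k := (w k).1.2; pose t k := (w k).2.
have hE k : E (x k) (u k) (t k) by have [] := hw k.
pose delta k : R := 4 * k.+1%:R^-1.
have harm0 : (fun k => k.+1%:R^-1 : R) @ \oo --> (0 : R) := cvg_harmonic.
have d0 : delta @ \oo --> (0 : R).
  by rewrite -(mulr0 4); apply: cvgMr.
(* the parallelogram identity at the midpoint of two points of E *)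
have hpar p q : ip (x p - x q) (x p - x q) + ip (u p - u q) (u p - u q)
    <= delta p + delta q.
  have hs : 0 <= (2^-1 : R) <= 1 by lra.
  have := Em _ _ _ (Econv _ _ _ _ _ _ _ (hE p) (hE q) hs).
  have [_] := hw p; have [_] := hw q.
  rewrite -/(x p) -/(x q) -/(u p) -/(u q) -/(t p) -/(t q) /delta.
  rewrite !ipE.
  rewrite (ip_sym ip (x q) (x p)) (ip_sym ip (u q) (u p)).
  move: (p.+1%:R^-1 : R) (q.+1%:R^-1 : R) (t p : R) (t q : R) => P Q a b'.
  move: (ip (x p) (x p)) (ip (x p) (x q)) (ip (x q) (x q)) => X1 X2 X3.
  move: (ip (u p) (u p)) (ip (u p) (u q)) (ip (u q) (u q)) => U1 U2 U3.
  lra.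
have ip_ge0 y : 0 <= ip y y by rewrite hip exprn_ge0.
have [x0 xx0] : exists x0 : H, x @ \oo --> x0.
  apply: (@cvg_of_sqr_dist _ _ _ delta d0) => p q; rewrite -hip.
  by apply: le_trans (hpar p q); rewrite lerDl.
have [u0 uu0] : exists u0 : H, u @ \oo --> u0.
  apply: (@cvg_of_sqr_dist _ _ _ delta d0) => p q; rewrite -hip.
  by apply: le_trans (hpar p q); rewrite lerDr.
have qq0 : (ip (x k) (x k) + ip (u k) (u k)) / 2 @[k --> \oo] -->
    (ip x0 x0 + ip u0 u0) / 2.
  by apply: cvgMl; apply: cvgD; apply: (cvg_ip hip).
have ff0 : t k + (ip (x k) (x k) + ip (u k) (u k)) / 2 @[k --> \oo] --> m.
  apply: (@squeeze_cvgr _ _ _ _ (fun=> m) (fun k => m + k.+1%:R^-1)).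
  - apply: nearW => k; rewrite Em //=.
    by have [_ /ltW] := hw k.
  - exact: cvg_cst.
  - by rewrite -{2}(addr0 m); apply: cvgD => //; exact: cvg_cst.
have tt0 : t @ \oo --> m - (ip x0 x0 + ip u0 u0) / 2.
  have -> : t = (fun k => t k + (ip (x k) (x k) + ip (u k) (u k)) / 2
      - (ip (x k) (x k) + ip (u k) (u k)) / 2).
    by apply: funext => k; rewrite addrK.
  exact: cvgB.
exists x0, u0, (m - (ip x0 x0 + ip u0 u0) / 2); split.
  exact: Eclos hE xx0 uu0 tt0.
by move=> y v s Es; rewrite subrK; exact: Em.
Qed.

Lemma quadratic_slope_ge0 (R : realType) (D N : R) : 0 <= N ->
  (forall s, 0 <= s <= 1 -> 0 <= s * D + s ^+ 2 * N / 2) -> 0 <= D.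
Proof.
move=> N0 hs; rewrite leNgt; apply/negP => D0.
have ND : 0 < N - D by lra.
(* if D < 0, the step s = - D / (N - D) makes the quadratic negative *)
have := hs (- D / (N - D)); rewrite ler_pdivrMr // divr_ge0; [|lra..].
have -> : - D / (N - D) * D + (- D / (N - D)) ^+ 2 * N / 2 =
  (D / (N - D)) ^+ 2 * (D - N / 2) by field; lra.
have s0 : 0 < (D / (N - D)) ^+ 2.
  by rewrite exprn_even_gt0 //= mulf_neq0 ?invr_neq0 //; lra.
have : - D <= 1 * (N - D) by lra.
move=> -> /(_ isT); rewrite pmulr_rge0 //; lra.
Qed.

(** The hypothesis [hmax] says that [G], the graph of an operator, is maximal
    monotone; the conclusion is that [0] is in the range of the identity plus
    that operator. *)
Lemma minty (R : realType) (H : completeNormedModType R)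
    (ip : {dot H for idfun}) (hip : forall x : H, ip x x = `|x| ^+ 2)
    (G : H -> H -> Prop)
    (hmax : forall x u,
       G x u <-> (forall y v, G y v -> 0 <= ip (x - y) (u - v))) :
  exists x, G x (- x).
Proof.
(* the epigraph of the Fitzpatrick function of G *)
pose E x u t := forall y v, G y v -> ip x v + ip y u - ip y v <= t.
have ip_ge0 y : 0 <= ip y y by rewrite hip exprn_ge0.
have expand x u y v :
    ip (x - y) (u - v) = ip x u - (ip x v + ip y u - ip y v).
  by rewrite !ipE /=; ring.
have GE y v : G y v -> E y v (ip y v).
  move=> Gyv z w Gzw; have /hmax /(_ z w Gzw) := Gyv.
  by rewrite expand subr_ge0.
have [y1 [v1 G1]] : exists y v, G y v.
  apply: contrapT => nG; apply: (nG); exists 0, 0; apply/hmax => y v Gyv.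
  by case: nG; exists y, v.
have Elb x u t : E x u t -> ip x u <= t.
  move=> Et; have [Gxu|nG] := pselect (G x u).
    by have := Et _ _ Gxu; rewrite addrK.
  rewrite leNgt; apply/negP => lt; apply: nG; apply/hmax => y v Gyv.
  by rewrite expand; have := Et _ _ Gyv; lra.
have Econv x u t x' u' t' s : E x u t -> E x' u' t' -> 0 <= s <= 1 ->
    E (x + s *: (x' - x)) (u + s *: (u' - u)) (t + s * (t' - t)).
  move=> Et Et' /andP[s0 s1] y v Gyv.
  have h := Et _ _ Gyv; have h' := Et' _ _ Gyv.
  rewrite !ipE.
  by move: h h'; nra.
have Eclos (x u : nat -> H) (t : nat -> R) x0 u0 t0 :
    (forall k, E (x k) (u k) (t k)) ->
    x @ \oo --> x0 -> u @ \oo --> u0 -> t @ \oo --> t0 -> E x0 u0 t0.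
  move=> Ek xx0 uu0 tt0 y v Gyv; rewrite -subr_ge0.
  have hc : t k - (ip (x k) v + ip y (u k) - ip y v) @[k --> \oo] -->
      t0 - (ip x0 v + ip y u0 - ip y v).
    apply: cvgB => //; apply: cvgB; last exact: cvg_cst.
    apply: cvgD; apply: (cvg_ip hip) => //; exact: cvg_cst.
  apply: (cvgr_to_ge hc); apply: nearW => k.
  by rewrite subr_ge0; exact: Ek.
have E1 : exists x u t, E x u t by exists y1, v1, (ip y1 v1); exact: GE.
have fge0 x u t : E x u t -> 0 <= t + (ip x x + ip u u) / 2.
  move=> /Elb Et; have := ip_ge0 (x + u).
  by rewrite !ipE (ip_sym ip u x); lra.
have [x0 [u0 [t0 [E0 hmin]]]] := epigraph_minimizer hip E1 Econv Eclos fge0.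
(* first-order optimality: the derivative along segments from (x0, u0, t0) *)
have foc x u t : E x u t ->
    0 <= t - t0 + (ip x0 (x - x0) + ip u0 (u - u0)).
  move=> Et.
  apply: (@quadratic_slope_ge0 _ _ (ip (x - x0) (x - x0) + ip (u - u0) (u - u0))).
    by rewrite addr_ge0.
  move=> s hs; have := hmin _ _ _ (Econv _ _ _ _ _ _ _ E0 Et hs).

  move: (x - x0) (u - u0) => dx du.
  rewrite !ipE (ip_sym ip dx x0) (ip_sym ip du u0) -subr_ge0.
  by congr (0 <= _); field.
(* (- u0, - x0) is monotonically related to G, with a quantitative margin that
   forces u0 = - x0 once that point itself is known to lie in G *)
have key y v : G y v -> ip (x0 + u0) (x0 + u0) <= ip (- u0 - y) (- x0 - v).
  move=> Gyv; have := foc _ _ _ (GE _ _ Gyv); have := Elb _ _ _ E0.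
  rewrite !ipE /=.
  rewrite (ip_sym ip u0 x0) (ip_sym ip y x0); lra.
have G0 : G (- u0) (- x0).
  by apply/hmax => y v Gyv; exact: le_trans (ip_ge0 _) (key _ _ Gyv).
have := key _ _ G0; rewrite !subrr linear0l hip.
rewrite le_eqVlt ltNge exprn_ge0 // orbF sqrf_eq0 normr_eq0 addr_eq0.
move=> /eqP x0u0.
by exists x0; rewrite {1}x0u0.
Qed.

(** * A square factor of a Gram matrix *)

(** One Gram-Schmidt step: [q] is [a] normalized and [N'] is the part of [N]
    orthogonal to [q].  When [a = 0], both [s] and [q] vanish, so the last
    identity replaces [q^T q = 1]. *)
Lemma gram_schmidt_col (R : rcfType) (d m : nat) (a : 'cV[R]_d)
    (N : 'M[R]_(d, m)) :
  exists s (q : 'cV[R]_d) (N' : 'M[R]_(d, m)),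
    [/\ a^T *m a = (s * s)%:M, a = s *: q, N = q *m (q^T *m N) + N',
        q^T *m N' = 0 & q *m (q^T *m q) = q].
Proof.
pose s := Num.sqrt ((a^T *m a) 0 0); pose q := s^-1 *: a.
have ss : a^T *m a = (s * s)%:M.
  rewrite -expr2 sqr_sqrtr; first exact: mx11_scalar.
  by rewrite mxE sumr_ge0 // => i _; rewrite mxE -expr2 sqr_ge0.
have a0 : s = 0 -> a = 0.
  move=> s0; apply/colP => i; rewrite mxE; apply/eqP.
  have : (a^T *m a) 0 0 = 0 by rewrite ss s0 mul0r mxE mul0rn.
  rewrite mxE => /eqP; rewrite psumr_eq0; last first.
    by move=> j _; rewrite mxE -expr2 sqr_ge0.
  by move/allP/(_ i (mem_index_enum _)); rewrite mxE -expr2 sqrf_eq0.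
have asq : a = s *: q.
  rewrite /q; have [/a0 ->|sn0] := eqVneq s 0; first by rewrite !scaler0.
  by rewrite scalerA mulfV // scale1r.
have qq : q *m (q^T *m q) = q.
  rewrite /q [(_ *: a)^T]linearZ /= -!(scalemxAl, scalemxAr) ss mul_mx_scalar.
  have [/a0 ->|sn0] := eqVneq s 0; first by rewrite !scaler0.
  by rewrite !scalerA; congr (_ *: _); field.
exists s, q, (N - q *m (q^T *m N)); split=> //; first by rewrite addrC subrK.
have qTqq : q^T *m q *m q^T = q^T.
  by have := congr1 trmx qq; rewrite !trmx_mul trmxK.
by rewrite mulmxBr !mulmxA qTqq subrr.
Qed.

(** The triangular factor [T] of a QR decomposition [M = P^T T], taken square
    whatever the rank and the number of rows of [M]; [P] need not have
    orthonormal rows when [M] is rank deficient. *)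
Lemma square_gram_factor (R : rcfType) (d m : nat) (M : 'M[R]_(d, m)) :
  exists (T : 'M[R]_m) (P : 'M[R]_(m, d)),
    T^T *m T = M^T *m M /\ M^T = T^T *m P.
Proof.
elim: m M => [|m IH] M.
  by exists 0, 0; split; apply/matrixP => [[]].
rewrite -[M](@hsubmxK _ d 1 m).
move: (@lsubmx _ d 1 m M) (@rsubmx _ d 1 m M) => a N.
have [s [q [N' [ss aq NE qN' qq]]]] := gram_schmidt_col a N.
have [T [P [TT TP]]] := IH N'.
set r := q^T *m N in NE.
have qr : q^T *m q *m r = r.
  have := congr1 trmx qq; rewrite !trmx_mul trmxK => qTqq.
  by rewrite /r [LHS]mulmxA qTqq.
have aN : a^T *m N = s *: r by rewrite aq linearZ /= -scalemxAl.
have NTa : N^T *m a = s *: r^T.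
  by have := congr1 trmx aN; rewrite trmx_mul trmxK [(_ *: r)^T]linearZ.
have N'q : N'^T *m q = 0 by rewrite -[q]trmxK -trmx_mul qN' trmx0.
pose T1 : 'M[R]_(1 + m) := block_mx s%:M r 0 T.
pose P1 : 'M[R]_(1 + m, d) := col_mx q^T P.
suff: T1^T *m T1 = (row_mx a N)^T *m row_mx a N /\ (row_mx a N)^T = T1^T *m P1.
  by exists T1, P1.
rewrite /T1 /P1; split.
- rewrite tr_block_mx mulmx_block tr_row_mx mul_col_row !trmx0 !mul0mx !mulmx0.
  rewrite !addr0 tr_scalar_mx -scalar_mxM ss aN mul_scalar_mx mul_mx_scalar TT.
  congr block_mx; first by rewrite NTa.
  have -> : N^T = r^T *m q^T + N'^T.
    by rewrite NE [(_ + _)^T]linearD /= trmx_mul.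
  have qN : q^T *m N = r by [].
  have N'N : N'^T *m N = N'^T *m N'.
    by rewrite {1}NE mulmxDr mulmxA N'q mul0mx add0r.
  by rewrite mulmxDl -mulmxA qN N'N.
- rewrite tr_block_mx mul_block_col tr_row_mx trmx0 mul0mx addr0 tr_scalar_mx.
  by rewrite mul_scalar_mx aq linearZ /= NE [(_ + _)^T]linearD /= trmx_mul TP.
Qed.

Lemma gram_mul_eq0 (R : realDomainType) (d m p : nat) (M : 'M[R]_(d, m))
    (B : 'M[R]_(m, p)) : M^T *m M *m B = 0 -> M *m B = 0.
Proof.
move=> MB; have : (M *m B)^T *m (M *m B) = 0.
  by rewrite trmx_mul -mulmxA (mulmxA M^T) MB mulmx0.
move: (M *m B) => N NN; apply/matrixP => i j; rewrite mxE; apply/eqP.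
have /matrixP /(_ j j) := NN; rewrite !mxE => /eqP.
rewrite psumr_eq0; last by move=> k _; rewrite mxE -expr2 sqr_ge0.
by move/allP/(_ i (mem_index_enum _)); rewrite mxE -expr2 sqrf_eq0.
Qed.

(** Since the columns of [M] sum to zero, one of them is redundant and the
    square factor of the others suffices. *)
Lemma short_gram_factor (R : rcfType) (d n : nat) (hn : (0 < n)%N)
    (M : 'M[R]_(d, n)) :
  M^T *m M *m (const_mx 1 : 'cV[R]_n) = 0 ->
  exists (T : 'M[R]_(n.-1, n)) (P : 'M[R]_(n.-1, d)),
    T^T *m T = M^T *m M /\ M^T = T^T *m P.
Proof.
case: n hn M => // n _ M /gram_mul_eq0 M1.
(* M is its last n columns N times B, the first column being - N 1 *)
pose B : 'M[R]_(n, 1 + n) := row_mx (- const_mx 1) 1%:M.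
have [T [P [TT TP]]] := square_gram_factor (@rsubmx _ d 1 n M).
have MB : M = @rsubmx _ d 1 n M *m B.
  rewrite mul_mx_row mulmx1.
  suff <- : @lsubmx _ d 1 n M = @rsubmx _ d 1 n M *m (- const_mx 1).
    by rewrite hsubmxK.
  apply/eqP; rewrite mulmxN -addr_eq0 -{1}(mulmx1 (lsubmx _)) -mul_row_col.
  rewrite hsubmxK -M1; apply/eqP; congr mulmx; apply/matrixP => i j.
  rewrite !mxE; case: splitP => k _; rewrite ?mxE //.
  by rewrite !ord1.
exists (T *m B), P; split; last by rewrite {1}MB !trmx_mul TP mulmxA.
by rewrite [in RHS]MB !trmx_mul -!mulmxA !(mulmxA _ _ B) TT.
Qed.

(** * Resolvents of maximal monotone operators *)

(** A maximal monotone operator contains every pair monotonically related to its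
    graph. *)
Lemma maximal_monotoneP (R : realType) (H : completeNormedModType R)
    (ip : {dot H for idfun}) (hip : forall x : H, ip x x = `|x| ^+ 2)
    (T : H -> set H) : maximal_monotone ip T ->
  forall x u, T x u <-> (forall y v, T y v -> 0 <= ip (x - y) (u - v)).
Proof.
move=> [mon maxT] x u; split=> [Txu y v|rel]; first exact: mon.
pose S y v := T y v \/ y = x /\ v = u.
have SE : S = T; last by rewrite -SE; right.
apply: maxT; last by move=> y v; left.
move=> y z v w [Tyv|[-> ->]] [Tzw|[-> ->]].
- exact: mon.
- by rewrite -(opprB x) -(opprB u) ip_oppl ip_oppr opprK; exact: rel.
- exact: rel.
- by rewrite !subrr hip exprn_ge0.
Qed.

(** The resolvent with an arbitrary positive step is defined everywhere: this is
    [minty] for the operator whose graph is [T] translated by [w] and rescaled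
    by [kappa]. *)
Lemma maximal_monotone_solve (R : realType) (H : completeNormedModType R)
    (ip : {dot H for idfun}) (hip : forall x : H, ip x x = `|x| ^+ 2)
    (T : H -> set H) (kappa : R) (w : H) :
  maximal_monotone ip T -> 0 < kappa -> exists x, T x (w - kappa *: x).
Proof.
move=> hT k0; have maxT := maximal_monotoneP hip hT.
have [x u|x Tx] := @minty _ _ ip hip (fun x u => T x (w + kappa *: u)).
  split=> [Txu y v Tyv|rel].
    have /maxT /(_ _ _ Tyv) := Txu.
    by rewrite opprD addrACA subrr add0r -scalerBr ip_scaler pmulr_rge0.
  apply/maxT => y v Tyv.
  have vE : v = w + kappa *: (kappa^-1 *: (v - w)).
    by rewrite scalerA mulfV ?gt_eqF // scale1r addrC subrK.
  move: (kappa^-1 *: (v - w)) vE Tyv => v' -> Tyv; have := rel _ _ Tyv.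
  by rewrite opprD addrACA subrr add0r -scalerBr ip_scaler pmulr_rge0.
by exists x; rewrite -scalerN.
Qed.

Lemma monotone_solve_uniq (R : realType) (H : completeNormedModType R)
    (ip : {dot H for idfun}) (hip : forall x : H, ip x x = `|x| ^+ 2)
    (T : H -> set H) (kappa : R) (w x y : H) :
  monotone_op ip T -> 0 < kappa ->
  T x (w - kappa *: x) -> T y (w - kappa *: y) -> x = y.
Proof.
move=> mon k0 Tx Ty; have := mon _ _ _ _ Tx Ty.
have -> : w - kappa *: x - (w - kappa *: y) = - (kappa *: (x - y)).
  by rewrite scalerBr !opprB addrC addrA subrK.
rewrite ip_oppr ip_scaler hip oppr_ge0 pmulr_rle0 //.
rewrite le_eqVlt ltNge exprn_ge0 // orbF sqrf_eq0 normr_eq0 subr_eq0.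
by move/eqP.
Qed.

(** The resolvent of a product of monotone operators is the singleton [x] as
    soon as it contains [x], which is tested componentwise. *)
Lemma resolvent_prodP (R : realType) (H : completeNormedModType R)
    (ip : {dot H for idfun}) (hip : forall x : H, ip x x = `|x| ^+ 2)
    (n : nat) (A : 'I_n -> H -> set H) (w x : {ffun 'I_n -> H}) :
  (forall i, monotone_op ip (A i)) ->
  resolvent (prod_op A) w = [set x] <-> (forall i, A i (x i) (w i - x i)).
Proof.
move=> mon; have resE y : resolvent (prod_op A) w y <->
    (forall i, A i (y i) (w i - y i)).
  split=> [[u Au <-] i|Ay]; first by rewrite ffunE addrC addKr; exact: Au.
  exists (w - y); last by rewrite addrC subrK.
  by move=> i; rewrite !ffunE; exact: Ay.
split=> [resx|Ax]; first by apply/resE; rewrite resx.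
apply/seteqP; split=> [y /resE Ay|y ->] /=; last exact/resE.
apply/ffunP => i; apply: (monotone_solve_uniq hip (mon i) ltr01 (w := w i)).
- by rewrite scale1r.
- by rewrite scale1r.
Qed.

(** Forward substitution: once the components below [k] are fixed, component [k]
    solves an inclusion with the positive coefficient [1 - L k k]. *)
Lemma lower_triangular_solve (R : realType) (H : completeNormedModType R)
    (ip : {dot H for idfun}) (hip : forall x : H, ip x x = `|x| ^+ 2)
    (n : nat) (A : 'I_n -> H -> set H) (L : 'M[R]_n) (v : {ffun 'I_n -> H}) :
  (forall i, maximal_monotone ip (A i)) -> is_trig_mx L ->
  (forall i, L i i < 1) ->
  exists x, resolvent (prod_op A) (v + lift_mx L x) = [set x].
Proof.
move=> maxA /is_trig_mxP trigL diagL.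
suff [x hx] : exists x : {ffun 'I_n -> H}, forall i : 'I_n, (i < n)%N ->
    A i (x i) ((v + lift_mx L x) i - x i).
  exists x; apply/(resolvent_prodP hip) => [i|i]; first by have [] := maxA i.
  exact: hx.
suff hk k : (k <= n)%N -> exists x : {ffun 'I_n -> H}, forall i : 'I_n,
    (i < k)%N -> A i (x i) ((v + lift_mx L x) i - x i) by exact: hk.
elim: k => [|k IH] kn; first by exists 0.
have [x hx] := IH (ltnW kn); pose o := Ordinal kn.
pose b := v o + \sum_(j | j != o) L o j *: x j.
have k0 : 0 < 1 - L o o by rewrite subr_gt0.
have [y Ay] := maximal_monotone_solve hip b (maxA o) k0.
exists [ffun i => if i == o then y else x i] => i ik.
have [->|io] := eqVneq i o.
  suff -> : (v + lift_mx L [ffun i => if i == o then y else x i]) o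
     - [ffun i => if i == o then y else x i] o = b - (1 - L o o) *: y.
    by rewrite ffunE eqxx.
  rewrite !ffunE eqxx (bigD1 o) //= ffunE eqxx /b scalerBl scale1r opprB.
  rewrite (eq_bigr (fun j => L o j *: x j)) => [|j /negPf jo]; last first.
    by rewrite ffunE jo.
  by rewrite -!addrA; congr (_ + _); rewrite addrCA.
(* rows above k do not see the new component, as L is lower triangular *)
have ltik : (i < k)%N.
  rewrite ltn_neqAle -ltnS ik andbT.
  by apply: contra io => /eqP ik'; apply/eqP/val_inj.
have := hx i ltik; rewrite !ffunE (negPf io); congr (A i _ (_ + _ - _)).
apply: eq_bigr => j _; rewrite ffunE; case: eqP => // ->.
by rewrite trigL // !scale0r.
Qed.

Lemma lower_triangular_uniq (R : realType) (H : completeNormedModType R)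
    (ip : {dot H for idfun}) (hip : forall x : H, ip x x = `|x| ^+ 2)
    (n : nat) (A : 'I_n -> H -> set H) (L : 'M[R]_n)
    (v x y : {ffun 'I_n -> H}) :
  (forall i, monotone_op ip (A i)) -> is_trig_mx L ->
  (forall i, L i i < 1) ->
  resolvent (prod_op A) (v + lift_mx L x) = [set x] ->
  resolvent (prod_op A) (v + lift_mx L y) = [set y] -> x = y.
Proof.
move=> mon /is_trig_mxP trigL diagL.
move=> /(resolvent_prodP hip _ _ mon) Ax /(resolvent_prodP hip _ _ mon) Ay.
suff xy k (i : 'I_n) : (i < k)%N -> x i = y i.
  by apply/ffunP => i; exact: (xy i.+1).
elim: k i => // k IH i ik.
have k0 : 0 < 1 - L i i by rewrite subr_gt0.
pose b (z : {ffun 'I_n -> H}) := v i + \sum_(j | j != i) L i j *: z j.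
have bE z : (v + lift_mx L z) i - z i = b z - (1 - L i i) *: z i.
  rewrite !ffunE (bigD1 i) //= /b scalerBl scale1r opprB.
  by rewrite -!addrA; congr (_ + _); rewrite addrCA.
have bxy : b x = b y.
  congr (_ + _); apply: eq_bigr => j ji; have [lij|] := ltnP i j.
    by rewrite trigL // !scale0r.
  rewrite leq_eqVlt => /orP[/eqP/val_inj ej|lji].
    by rewrite ej eqxx in ji.
  by rewrite IH // (leq_trans lji).
have := Ax i; have := Ay i; rewrite !bE -bxy => hy hx.
exact: (monotone_solve_uniq hip (mon i) k0 hx hy).
Qed.

(** * The iteration in terms of the Gram matrix *)

Lemma lift_mxD (R : realType) (H : lmodType R) (m n : nat)
    (K : 'M[R]_(m, n)) (x y : {ffun 'I_n -> H}) :
  lift_mx K (x + y) = lift_mx K x + lift_mx K y.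
Proof.
apply/ffunP => i; rewrite !ffunE -big_split; apply: eq_bigr => j _ /=.
by rewrite ffunE scalerDr.
Qed.

Lemma lift_mxZ (R : realType) (H : lmodType R) (m n : nat)
    (K : 'M[R]_(m, n)) (a : R) (x : {ffun 'I_n -> H}) :
  lift_mx K (a *: x) = a *: lift_mx K x.
Proof.
apply/ffunP => i; rewrite !ffunE scaler_sumr; apply: eq_bigr => j _ /=.
by rewrite ffunE !scalerA mulrC.
Qed.

Lemma lift_mxM (R : realType) (H : lmodType R) (m n p : nat)
    (K : 'M[R]_(m, n)) (B : 'M[R]_(n, p)) (x : {ffun 'I_p -> H}) :
  lift_mx (K *m B) x = lift_mx K (lift_mx B x).
Proof.
apply/ffunP => i; rewrite !ffunE.
under eq_bigr do rewrite mxE scaler_suml.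
rewrite exchange_big; apply: eq_bigr => j _ /=.
rewrite ffunE scaler_sumr; apply: eq_bigr => k _.
by rewrite scalerA.
Qed.

(** The sequences [x] with [x k = J_A (- v k + L (x k))], where
    [v 0 = v0] and [v k.+1 = v k + gamma W (x k)]; the recursion for [v] is
    solved as a sum over the past iterates. *)
Definition gram_sequences (R : realType) (H : lmodType R) (n : nat)
    (A : 'I_n -> H -> set H) (gamma : R) (L W : 'M[R]_n)
    (v0 : {ffun 'I_n -> H}) : set (nat -> {ffun 'I_n -> H}) :=
  [set x : nat -> {ffun 'I_n -> H} | forall k, resolvent (prod_op A)
     (- (v0 + gamma *: \sum_(j < k) lift_mx W (x j)) + lift_mx L (x k))
       = [set x k]].

Lemma x_sequences_gram (R : realType) (H : lmodType R) (n d : nat)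
    (A : 'I_n -> H -> set H) (gamma : R) (L : 'M[R]_n) (M : 'M[R]_(d, n))
    (z0 : {ffun 'I_d -> H}) :
  x_sequences A gamma L M z0 =
  gram_sequences A gamma L (M^T *m M) (lift_mx M^T z0).
Proof.
have sumS (f : nat -> {ffun 'I_d -> H}) k : z0 + gamma *: \sum_(j < k.+1) f j =
    z0 + gamma *: \sum_(j < k) f j + gamma *: f k.
  by rewrite big_ord_recr /= scalerDr addrA.
have liftE (x : nat -> {ffun 'I_n -> H}) k :
    lift_mx M^T (z0 + gamma *: \sum_(j < k) lift_mx M (x j)) =
    lift_mx M^T z0 + gamma *: \sum_(j < k) lift_mx (M^T *m M) (x j).
  rewrite lift_mxD lift_mxZ; congr (_ + _ *: _).
  elim: k => [|k IH]; last by rewrite !big_ord_recr /= lift_mxD IH lift_mxM.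
  rewrite !big_ord0; apply/ffunP => i; rewrite !ffunE big1 // => j _.
  by rewrite ffunE scaler0.
apply/seteqP; split=> x /=.
  move=> [z [z00 hz]] k; have [<- _] := hz k; rewrite -liftE.
  suff -> : z k = z0 + gamma *: \sum_(j < k) lift_mx M (x j) by [].
  elim: k => [|k IH]; first by rewrite big_ord0 scaler0 addr0.
  by rewrite (sumS (fun j => lift_mx M (x j))) -IH; have [] := hz k.
move=> hx; exists (fun k => z0 + gamma *: \sum_(j < k) lift_mx M (x j)); split.
  by rewrite big_ord0 scaler0 addr0.
move=> k; rewrite liftE; split; first exact: hx.
exact: (sumS (fun j => lift_mx M (x j))).
Qed.

Lemma gram_sequences_singleton (R : realType) (H : completeNormedModType R)
    (ip : {dot H for idfun}) (hip : forall x : H, ip x x = `|x| ^+ 2)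
    (n : nat) (A : 'I_n -> H -> set H) (gamma : R) (L W : 'M[R]_n)
    (v0 : {ffun 'I_n -> H}) :
  (forall i, maximal_monotone ip (A i)) -> is_trig_mx L ->
  (forall i, L i i < 1) ->
  exists x, gram_sequences A gamma L W v0 = [set x].
Proof.
move=> maxA trigL diagL.
have /choice [X hX] (v : {ffun 'I_n -> H}) : exists x,
    resolvent (prod_op A) (- v + lift_mx L x) = [set x].
  exact: (lower_triangular_solve hip).
pose v k := iter k (fun v => v + gamma *: lift_mx W (X v)) v0.
have vE k : v k = v0 + gamma *: \sum_(j < k) lift_mx W (X (v j)).
  elim: k => [|k IH]; first by rewrite big_ord0 scaler0 addr0.
  by rewrite big_ord_recr /= scalerDr addrA -IH.
exists (X \o v); apply/seteqP; split=> [y hy|y -> k /=]; last first.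
  by rewrite -vE; exact: hX.
have hyX k : forall j, (j < k)%N -> y j = X (v j).
  elim: k => // k IH j jk.
  have mon i : monotone_op ip (A i) by have [] := maxA i.
  apply: (lower_triangular_uniq hip mon trigL diagL _ (hX (v j))).
  rewrite vE -[RHS](hy j).
  suff -> : \sum_(l < j) lift_mx W (X (v l)) = \sum_(l < j) lift_mx W (y l).
    by [].
  by apply: eq_bigr => l _; rewrite IH // (leq_trans (ltn_ord l)).
by apply: funext => k; exact: (hyX k.+1).
Qed.

(** * Reduction to minimal lifting *)

Theorem theorem3 (R : realType) (n : nat) (hn : (2 <= n)%N)
    (H : completeNormedModType R) (ip : {dot H for idfun})
    (hip : forall x : H, ip x x = `|x| ^+ 2)
    (A : 'I_n -> H -> set H)
    (hA : forall i, maximal_monotone ip (A i))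
    (hzero : exists x : H, sum_op A x 0)
    (gamma : R) (d : nat) (M : 'M[R]_(d, n)) (L : 'M[R]_n)
    (hL : is_trig_mx L)
    (W Z : 'M[R]_n) (hW : W = M^T *m M) (hZ : Z = 2%:M - L - L^T)
    (c epsilon : R) (hc : 0 < c) (heps : 0 <= epsilon < 2)
    (C : set ('M[R]_n * 'M[R]_n))
    (hC : C `<=` [set K | psdmx K.1 /\ K.2 \is symmetricmx])
    (hWpsd : psdmx W) (hZsym : Z \is symmetricmx)
    (hW1 : W *m (const_mx 1 : 'cV[R]_n) = 0)
    (hlambda : c <= lambda 1 W + lambda 2 W)
    (hZW : loewner_ge Z W)
    (hZ1 : (const_mx 1 : 'cV[R]_n)^T *m Z *m (const_mx 1 : 'cV[R]_n) = 0)
    (hdiag : forall i, Z i i = Z (first_index hn) (first_index hn))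
    (hZ11 : 2 - epsilon <= Z (first_index hn) (first_index hn) <= 2 + epsilon)
    (hWZ : C (W, Z)) :
  exists Mt : 'M[R]_(n.-1, n),
    forall z0 : {ffun 'I_d -> H},
    exists zt0 : {ffun 'I_n.-1 -> H},
    exists x : nat -> {ffun 'I_n -> H},
      x_sequences A gamma L M z0 = [set x] /\
      x_sequences A gamma L Mt zt0 = [set x].
Proof.
have diagL i : L i i < 1.
  have Zii : Z i i = 2 - L i i - L i i by rewrite hZ !mxE eqxx mulr1n.
  move: heps hZ11 => /andP[_ e2] /andP[Z1 _].
  by rewrite -(hdiag i) Zii in Z1; lra.
rewrite hW in hW1.
have [Mt [P [MtMt MP]]] := short_gram_factor (ltnW hn) hW1.
exists Mt => z0; exists (lift_mx P z0).
rewrite !x_sequences_gram MtMt -lift_mxM -MP.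
have [x ->] := gram_sequences_singleton hip gamma (M^T *m M) (lift_mx M^T z0)
  hA hL diagL.
by exists x.
Qed.
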